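(* If $\Lambda$ is a rank-$3$ lattice in $\mathbb{E}^3$ preserved by the group $\tilde{\mathbf{D}}_4$, then there exists a diagonal transformation $D=\mathrm{diag}(a,a,b)$ for some $a,b>0$ such that $$\Lambda D^{-1}\in\{\Lambda_{(1,0,0)},\ \Lambda_{(1,1,1)},\ \Lambda_{(1,1,0)},\ \Lambda_{(1,1)}\oplus e_3\}.$$
   Context: A rank-$d$ lattice is the set of integer linear combinations of $d$ linearly independent vectors of $\mathbb{E}^3$. $\tilde{\mathbf{D}}_4$ is the group of order $8$ generated by two reflections in planes containing the $z$-axis and meeting at angle $\frac{\pi}{4}$, one of the planes being $x=0$ (so it is generated by the reflections in $x=0$ and $x=y$). A lattice is preserved by a group of linear isometries if every element of the group maps the lattice to itself. $\{e_1,e_2,e_3\}$ is the standard basis; $\Lambda T=\{vT:v\in\Lambda\}$ for a linear map $T$. $\Lambda_{(1,0,0)}=\mathbb{Z}^3$; $\Lambda_{(1,1,1)}$ is the set of integral vectors all of whose coordinates have the same parity; $\Lambda_{(1,1,0)}$ is the set of integral vectors whose coordinate sum is even. $\Lambda_{(1,1)}$ is the rank-$2$ lattice generated by $e_1+e_2,e_1-e_2$. For a lattice $\Lambda_0$ in a subspace $V$ and a vector $w\notin V$, $\Lambda_0\oplus w=\bigcup_{k\in\mathbb{Z}}(\Lambda_0+kw)$. *)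

(* Defs.v *)
(* Points of E^3 are row vectors; linear maps act on the right, v |-> v *m T. *)
From HB Require Import structures.
From mathcomp Require Import all_boot all_order all_algebra.
From mathcomp Require Import all_classical all_reals.

Set Implicit Arguments.
Unset Strict Implicit.
Unset Printing Implicit Defensive.

Import Order.TTheory GRing.Theory Num.Theory.
Local Open Scope classical_set_scope.
Local Open Scope ring_scope.

Definition vec3 (R : realType) (x y z : R) : 'rV[R]_3 :=
  \row_j nth 0 [:: x; y; z] j.

Definition e1 (R : realType) : 'rV[R]_3 := vec3 1 0 0.
Definition e2 (R : realType) : 'rV[R]_3 := vec3 0 1 0.
Definition e3 (R : realType) : 'rV[R]_3 := vec3 0 0 1.

Definition int_vec (R : realType) (n : nat) (c : 'rV[int]_n) : 'rV[R]_n :=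
  map_mx intr c.

Definition int_span (R : realType) (d : nat) (B : 'M[R]_(d, 3)) :
    set 'rV[R]_3 :=
  [set int_vec R c *m B | c in [set: 'rV[int]_d]].

Definition is_lattice (R : realType) (d : nat) (L : set 'rV[R]_3) : Prop :=
  exists B : 'M[R]_(d, 3), row_free B /\ L = int_span B.

Definition set_mul (R : realType) (L : set 'rV[R]_3) (T : 'M[R]_3) :
    set 'rV[R]_3 :=
  [set v *m T | v in L].

Definition preserved_by (R : realType) (G : set 'M[R]_3)
    (L : set 'rV[R]_3) : Prop :=
  forall g, G g -> set_mul L g = L.

Definition dot (R : realType) (u v : 'rV[R]_3) : R := (u *m v^T) 0 0.

(* Matrix of the reflection v |-> v - 2 (v.n / n.n) n in the plane through 0
   with normal vector n. *)
Definition reflection (R : realType) (n : 'rV[R]_3) : 'M[R]_3 :=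
  1%:M - (2 / dot n n) *: (n^T *m n).

Definition matrix_group (R : realType) (G : set 'M[R]_3) : Prop :=
  [/\ forall g, G g -> g \in unitmx,
      G 1%:M,
      forall g h, G g -> G h -> G (g *m h) &
      forall g, G g -> G (invmx g)].

Definition generated_group (R : realType) (S : set 'M[R]_3) : set 'M[R]_3 :=
  smallest (@matrix_group R) S.

(* The generators are the reflections in the planes x = 0 and x = y. *)
Definition D4tilde (R : realType) : set 'M[R]_3 :=
  generated_group [set reflection (e1 R); reflection (e1 R - e2 R)].
Arguments D4tilde : clear implicits.

Definition Lambda100 (R : realType) : set 'rV[R]_3 :=
  [set int_vec R c | c in [set: 'rV[int]_3]].
Arguments Lambda100 : clear implicits.

Definition Lambda111 (R : realType) : set 'rV[R]_3 :=
  [set int_vec R c | c in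
    [set c : 'rV[int]_3 | forall i j, (c ord0 i = c ord0 j %[mod 2])%Z]].
Arguments Lambda111 : clear implicits.

Definition Lambda110 (R : realType) : set 'rV[R]_3 :=
  [set int_vec R c | c in
    [set c : 'rV[int]_3 | (2 %| \sum_j c ord0 j)%Z]].
Arguments Lambda110 : clear implicits.

Definition Lambda11 (R : realType) : set 'rV[R]_3 :=
  int_span (col_mx (e1 R + e2 R) (e1 R - e2 R)).
Arguments Lambda11 : clear implicits.

Definition lattice_oplus (R : realType) (L : set 'rV[R]_3) (w : 'rV[R]_3) :
    set 'rV[R]_3 :=
  \bigcup_(k in [set: int]) [set v + k%:~R *: w | v in L].

Definition diag_aab (R : realType) (a b : R) : 'M[R]_3 :=
  diag_mx (vec3 a a b).

(* Main.v *)
Require Import Defs.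
From mathcomp Require Import all_boot all_order all_algebra.
From mathcomp Require Import all_classical all_reals.
From mathcomp Require Import zify ring.

Import Order.TTheory GRing.Theory Num.Theory.
Local Open Scope classical_set_scope.
Local Open Scope ring_scope.

(** The lattice L is squeezed between a coarse and a fine orthogonal lattice,
which leaves only a subgroup of (Z/2)^3 to determine.

If v = (x, y, z) lies in L, the mirror symmetry in x = 0 puts the difference
(2x, 0, 0) of v and its mirror image in L; the symmetry in x = y then gives the
same for y, and adding to v its image (-x, -y, z) under the half-turn about the
z-axis shows that (0, 0, 2z) is in L.  So L
meets the x-axis and the z-axis in nonzero discrete groups, generated by some
2a e1 and 2b e3 with a, b > 0 ([lattice_line_cyclic]), and every coordinate of
a vector of L is an integral multiple of a, a, b respectively.  Hence L is the
image under diag(a, a, b) of a group M of integral vectors that contains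
2Z^3 and meets each coordinate axis exactly in the even vectors
([D4tilde_lattice_half_coordinates]).

Such an M is determined by its image in (Z/2)^3, a subgroup that is invariant
under exchanging the first two coordinates and contains none of 100, 010, 001.
Two of its nonzero elements cannot differ by one of these, so it is one of
0, {000, 111}, the even-weight subgroup and {000, 110}
([swap_invariant_classification]).  These are the four lattices of the theorem,
up to a further factor 2 on the coordinates where M has only even entries
([int_points_rescale]). *)

(** * Coordinates of row vectors *)

Lemma vec3_coord {R : realType} (v : 'rV[R]_3) :
  v = vec3 (v 0 0) (v 0 1) (v 0 2%:R).
Proof.
apply/rowP=> j; rewrite mxE.
by case: j => -[|[|[|//]]] hj /=; congr (v _ _); apply/val_inj.
Qed.

Lemma vec3_inj {R : realType} (x y z x' y' z' : R) :
  vec3 x y z = vec3 x' y' z' -> [/\ x = x', y = y' & z = z'].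
Proof.
by move/rowP=> h; split; [have := h 0|have := h 1|have := h 2%:R]; rewrite !mxE.
Qed.

Lemma vec3B {R : realType} (x y z x' y' z' : R) :
  vec3 x y z - vec3 x' y' z' = vec3 (x - x') (y - y') (z - z').
Proof. by apply/rowP=> -[[|[|[|//]]] hj]; rewrite !mxE. Qed.

Lemma vec3D {R : realType} (x y z x' y' z' : R) :
  vec3 x y z + vec3 x' y' z' = vec3 (x + x') (y + y') (z + z').
Proof. by apply/rowP=> -[[|[|[|//]]] hj]; rewrite !mxE. Qed.

Lemma vec3Z {R : realType} (t x y z : R) :
  t *: vec3 x y z = vec3 (t * x) (t * y) (t * z).
Proof. by apply/rowP=> -[[|[|[|//]]] hj]; rewrite !mxE. Qed.

Lemma dot_vec3 {R : realType} (x y z x' y' z' : R) :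
  dot (vec3 x y z) (vec3 x' y' z') = x * x' + y * y' + z * z'.
Proof. by rewrite /dot !mxE !big_ord_recr big_ord0 /= !mxE /= add0r. Qed.

Lemma mul_reflection {R : realType} (v n : 'rV[R]_3) :
  v *m reflection n = v - (2 / dot n n * dot v n) *: n.
Proof.
rewrite /reflection mulmxBr mulmx1 -scalemxAr mulmxA.
by rewrite [v *m n^T]mx11_scalar mul_scalar_mx scalerA.
Qed.

Lemma mul_diag_aab {R : realType} (a b x y z : R) :
  vec3 x y z *m diag_aab a b = vec3 (x * a) (y * a) (z * b).
Proof.
by apply/rowP=> -[[|[|[|//]]] hj]; rewrite /diag_aab mul_mx_diag !mxE.
Qed.

Lemma set_mul_invmx {R : realType} (L L' : set 'rV[R]_3) (D : 'M[R]_3) :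
  D \in unitmx -> (forall v, L (v *m D) <-> L' v) -> set_mul L (invmx D) = L'.
Proof.
move=> uD h; apply/seteqP; split=> [_ [v Lv <-]|v /h Lv].
  by apply/h; rewrite mulmxKV.
by exists (v *m D) => //; rewrite mulmxK.
Qed.

Lemma diag_aab_unit {R : realType} (a b : R) :
  0 < a -> 0 < b -> diag_aab a b \in unitmx.
Proof.
move=> a0 b0; rewrite unitmxE det_diag !big_ord_recr big_ord0 /= !mxE /= mul1r.
by rewrite unitfE !mulf_neq0 ?gt_eqF.
Qed.

(** * Discreteness of lattices *)

Lemma latticeB {R : realType} (L : set 'rV[R]_3) d :
  is_lattice d L -> forall u v, L u -> L v -> L (u - v).
Proof.
move=> [B [_ ->]] _ _ [c _ <-] [c' _ <-]; exists (c - c') => //.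
by rewrite /int_vec -mulmxBl map_mxB.
Qed.

(** A lattice of full rank lies in no coordinate plane: the basis matrix is
invertible, so it has no zero column. *)
Lemma lattice_coord_neq0 {R : realType} (L : set 'rV[R]_3) (j : 'I_3) :
  is_lattice 3 L -> exists2 v, L v & v 0 j != 0.
Proof.
move=> [B [freeB ->]]; apply: contrapT => h.
have colB0 : B *m delta_mx j 0 = 0 :> 'cV[R]_3.
  rewrite -colE; apply/colP=> i; rewrite !mxE; apply/eqP/negPn/negP=> Bij.
  apply: h; exists (row i B); last by rewrite mxE.
  exists (delta_mx 0 i) => //.
  by rewrite /int_vec map_delta_mx rowE.
have := congr1 (mulmx (invmx B)) colB0.
rewrite mulKmx ?mulmx0 -?row_free_unit // => /matrixP/(_ j 0).
by rewrite !mxE !eqxx => /eqP; rewrite oner_eq0.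
Qed.

(** Scaling by u turns S into a nonzero subgroup of Z, and the generator of S
comes from the least positive element of that subgroup by Euclidean division.
Working with the absolute value of u makes the generator positive. *)
Lemma discrete_subgroup_cyclic {R : realType} (S : set R) (u s : R) :
  (forall t t', S t -> S t' -> S (t - t')) ->
  (forall t, S t -> t * u \is a Num.int) -> u != 0 -> S s -> s != 0 ->
  exists2 g, 0 < g & forall t, S t <-> exists k : int, t = k%:~R * g.
Proof.
move=> SB Su u0 Ss s0.
have S0 : S 0 by rewrite -(subrr s); apply: SB.
have SN t : S t -> S (- t) by move=> St; rewrite -sub0r; apply: SB.
have SD t t' : S t -> S t' -> S (t + t').
  by move=> St St'; rewrite -(opprK t'); apply: SB => //; apply: SN.
have SMn t n : S t -> S (t *+ n).
  by move=> St; elim: n => [|n IH]; rewrite ?mulr0n // mulrS; apply: SD.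
have SMz t (k : int) : S t -> S (k%:~R * t).
  move=> St; rewrite mulrC mulrzr; case: k => n; first exact: SMn.
  by rewrite NegzE mulrNz; apply/SN/SMn.
have normu t (m : int) : t * u = m%:~R -> S t -> S (`|m|%:~R / `|u|).
  move=> tm St; rewrite intr_norm -tm normrM mulfK ?normr_eq0 //.
  by case: (ger0P t) => // _; apply: SN.
have exP : exists n : nat, (0 < n)%N && `[< S (n%:R / `|u|) >].
  have /intrP[m sm] := Su _ Ss.
  exists `|m|%N; rewrite absz_gt0; apply/andP; split.
    apply/eqP=> m0; have := mulf_neq0 s0 u0.
    by rewrite sm m0 eqxx.
  by apply/asboolP; have := normu _ _ sm Ss; rewrite -abszE.
case: (ex_minnP exP) => n /andP[n0 /asboolP Sn] nmin.
have nu0 : 0 < `|u| by rewrite normr_gt0.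
exists (n%:R / `|u|) => [|t]; first by rewrite divr_gt0 ?ltr0n.
split=> [St|[k ->]]; last exact: SMz.
(* The sign of u is absorbed into m. *)
have [m tm] : exists m : int, t = m%:~R / `|u|.
  have /intrP[m tm] := Su _ St.
  case: (ger0P u) => _.
    by exists m; rewrite -tm mulfK.
  by exists (- m); rewrite rmorphN /= -tm invrN mulrNN mulfK.
exists (m %/ n)%Z; rewrite tm {1}(divz_eq m n) rmorphD rmorphM /= mulrDl mulrA.
suff -> : (m %% n)%Z = 0 by rewrite mul0r addr0.
have r0 : 0 <= (m %% n)%Z by rewrite modz_ge0 // lt0n_neq0.
have rn : (m %% n)%Z < n by rewrite ltz_pmod.
have Sr : S ((m %% n)%Z%:~R / `|u|).
  rewrite /modz rmorphB rmorphM /= mulrBl -tm -mulrA.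
  by apply: SB => //; apply: SMz.
apply/eqP/negPn/negP=> rN0.
have := nmin `|(m %% n)%Z|%N; rewrite absz_gt0 rN0 /= leqNgt => H.
suff /H : `[< S (`|(m %% n)%Z|%N%:R / `|u|) >] by lia.
by apply/asboolP; rewrite natr_absz ger0_norm.
Qed.

(** In coordinates with respect to a basis of L, a vector t w of L has integral
entries, and one entry of w is nonzero: it serves as the scaling factor that
makes the group of such t discrete. *)
Lemma lattice_line_cyclic {R : realType} (L : set 'rV[R]_3) (w : 'rV[R]_3) s :
  is_lattice 3 L -> L (s *: w) -> s != 0 -> w != 0 ->
  exists2 g, 0 < g & forall t, L (t *: w) <-> exists k : int, t = k%:~R * g.
Proof.
move=> latL Ls s0 w0; have [B [freeB defL]] := latL.
have uB : B \in unitmx by rewrite -row_free_unit.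
have /rV0Pn[j wj] : w *m invmx B != 0.
  by apply: contraNneq w0 => h; rewrite -(mulmxKV uB w) h mul0mx.
apply: (discrete_subgroup_cyclic [set t | L (t *: w)] _ s _ _ wj) => //.
  by move=> t t' /= Lt Lt'; rewrite scalerBl; apply: latticeB latL _ _ _ _.
move=> t /=; rewrite defL => -[c _ cB].
have := congr1 (fun v => (v *m invmx B) 0 j) cB.
by rewrite /= mulmxK // -scalemxAl !mxE => <-; rewrite intr_int.
Qed.

(** * Subgroups of Z^3 modulo 2 *)

Definition oddz (i : int) : bool := ~~ (2 %| i)%Z.

Lemma dvd2z (i : int) : (2 %| i)%Z = ~~ oddz i.
Proof. by rewrite negbK. Qed.

Lemma oddzD (i j : int) : oddz (i + j) = oddz i (+) oddz j.
Proof. by rewrite /oddz; lia. Qed.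

Lemma oddzN (i : int) : oddz (- i) = oddz i.
Proof. by rewrite /oddz; lia. Qed.

Lemma oddz_bit (i : int) : oddz (oddz i)%:Z = oddz i.
Proof. by case: (oddz i). Qed.

(** The conditions on the axes say that M contains 2Z^3 and that its image N in
(Z/2)^3 contains no unit vector.  If N contains 101 then by symmetry it contains
011, hence their sum 110, and so all vectors of even weight; it then omits every
odd vector, since adding an even vector turns 111 or any unit vector into 001.
Otherwise N can only contain 110 or 111, and not both, as their sum is 001. *)
Lemma swap_invariant_classification (M : int -> int -> int -> Prop) :
  (forall i j k i' j' k', M i j k -> M i' j' k' ->
     M (i - i') (j - j') (k - k')) ->
  (forall i j k, M i j k -> M j i k) ->
  (forall i, M i 0 0 <-> (2 %| i)%Z) ->
  (forall k, M 0 0 k <-> (2 %| k)%Z) ->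
  [\/ forall i j k, M i j k <-> [&& 2 %| i, 2 %| j & 2 %| k]%Z,
      forall i j k, M i j k <-> (2 %| i - j)%Z && (2 %| i - k)%Z,
      forall i j k, M i j k <-> (2 %| i + j + k)%Z
    | forall i j k, M i j k <-> (2 %| i + j)%Z && (2 %| k)%Z].
Proof.
move=> MB Msw Mx Mz.
have shift i j k i' j' k' : oddz i = oddz i' -> oddz j = oddz j' ->
    oddz k = oddz k' -> M i j k -> M i' j' k'.
  move=> hi hj hk h.
  have even m m' : oddz m = oddz m' -> (2 %| m - m')%Z.
    by move=> e; rewrite dvd2z oddzD oddzN e addbb.
  have /Mx mi := even _ _ hi; have /Mx/Msw mj := even _ _ hj.
  have /Mz mk := even _ _ hk.
  have := MB _ _ _ _ _ _ (MB _ _ _ _ _ _ (MB _ _ _ _ _ _ h mi) mj) mk.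
  by rewrite !subr0 !subKr.
(* N is the image of M in (Z/2)^3, with exclusive or as addition. *)
pose N (b c d : bool) := M b c d.
have bits i j k : M i j k <-> N (oddz i) (oddz j) (oddz k).
  by split; apply: shift; rewrite oddz_bit.
have NB b c d b' c' d' : N b c d -> N b' c' d' -> N (b (+) b') (c (+) c') (d (+) d').
  move=> h h'; apply: shift (MB _ _ _ _ _ _ h h'); rewrite oddzD oddzN;
  by case: (b) (b') (c) (c') (d) (d') => [] [] [] [] [] [].
have N000 : N false false false by apply/Mx.
have N100 : ~ N true false false by move/Mx.
have N001 : ~ N false false true by move/Mz.
have N010 : ~ N false true false by move/Msw.
have N011 : N false true true <-> N true false true by split; apply: Msw.
have N101 : N true false true -> N true true false.
  by move=> h; have /N011 h' := h; apply: NB h h'.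
have N110_111 : N true true false -> ~ N true true true.
  by move=> h h'; apply/N001/(NB _ _ _ _ _ _ h h').
have parity := (dvd2z, oddzD, oddzN).
have [h110|h110] := pselect (N true true false).
  have [h101|h101] := pselect (N true false true); [apply: Or43|apply: Or44];
  move=> i j k; rewrite bits !parity;
  by case: (oddz i) (oddz j) (oddz k) => [] [] [] /=; split => //; tauto.
have [h111|h111] := pselect (N true true true); [apply: Or42|apply: Or41];
  move=> i j k; rewrite bits !parity;
  by case: (oddz i) (oddz j) (oddz k) => [] [] [] /=; split => //; tauto.
Qed.

(** * Lattices given by integral coordinates *)

(** The image under diag(a, a, b) of the set M of integral vectors. *)
Definition int_points {R : realType} (a b : R) (M : int -> int -> int -> Prop) :
    set 'rV[R]_3 :=
  [set v | exists i j k, M i j k /\ v = vec3 (i%:~R * a) (j%:~R * a) (k%:~R * b)].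

Lemma int_pointsE {R : realType} (P : set 'rV[int]_3) :
  [set int_vec R c | c in P] =
  int_points 1 1 (fun i j k => P (\row_m nth 0 [:: i; j; k] m)).
Proof.
apply/seteqP; split=> [_ [c Pc <-]|_ [i [j [k [Pc ->]]]]].
  exists (c 0 0), (c 0 1), (c 0 2%:R); rewrite !mulr1; split.
    suff <- : c = \row_m nth 0 [:: c 0 0; c 0 1; c 0 2%:R] m by [].
    by apply/rowP=> -[[|[|[|//]]] hm]; rewrite !mxE; congr (c _ _); apply/val_inj.
  by rewrite [LHS]vec3_coord !mxE.
exists (\row_m nth 0 [:: i; j; k] m) => //.
by rewrite [LHS]vec3_coord !mxE !mulr1.
Qed.

Lemma Lambda100E {R : realType} :
  Lambda100 R = int_points 1 1 (fun _ _ _ => True).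
Proof. exact: int_pointsE. Qed.

Lemma Lambda111E {R : realType} :
  Lambda111 R = int_points 1 1 (fun i j k => (2 %| i - j)%Z && (2 %| i - k)%Z).
Proof.
rewrite /Lambda111 int_pointsE; congr int_points.
apply/funext=> i; apply/funext=> j; apply/funext=> k; apply/propext => /=.
split=> [h|/andP[ij ik] p q].
  have := h 0 2%:R; have := h 0 1; rewrite !mxE /= => /eqP ij /eqP ik.
  by rewrite -!eqz_mod_dvd ij.
rewrite !mxE; apply/eqP; rewrite eqz_mod_dvd.
by case: p q => -[|[|[|//]]] hp [[|[|[|//]]] hq] /=; lia.
Qed.

Lemma Lambda110E {R : realType} :
  Lambda110 R = int_points 1 1 (fun i j k => (2 %| i + j + k)%Z).
Proof.
rewrite /Lambda110 int_pointsE; congr int_points.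
apply/funext=> i; apply/funext=> j; apply/funext=> k; congr (is_true (_ %| _)%Z).
by rewrite !big_ord_recr big_ord0 /= !mxE add0r.
Qed.

(** The vectors p (e1 + e2) + q (e1 - e2) + k e3 are the (p + q, p - q, k), and
integers i, j have the form p + q, p - q exactly when i + j is even. *)
Lemma Lambda11_oplus_e3E {R : realType} :
  lattice_oplus (Lambda11 R) (e3 R) =
  int_points 1 1 (fun i j _ => (2 %| i + j)%Z).
Proof.
have span (c : 'rV[int]_2) :
    int_vec R c *m col_mx (e1 R + e2 R) (e1 R - e2 R) =
    vec3 (c 0 0 + c 0 1)%:~R (c 0 0 - c 0 1)%:~R 0.
  have -> : int_vec R c = row_mx (c 0 0)%:~R%:M (c 0 1)%:~R%:M :> 'rV_(1 + 1).
    apply/rowP=> i; rewrite !mxE; case: splitP => m im; rewrite !mxE ord1 mulr1n;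
    by congr (c _ _)%:~R; apply/val_inj; rewrite /= im ord1.
  rewrite (@mul_row_col _ 1 1 1 3) !mul_scalar_mx.
  rewrite /e1 /e2 vec3D vec3B !vec3Z vec3D.
  by rewrite rmorphB rmorphD /=; congr vec3; ring.
apply/seteqP; split=> [_ [k _ [_ [c _ <-] <-]]|_ [i [j [k [ij ->]]]]].
  exists (c 0 0 + c 0 1), (c 0 0 - c 0 1), k; split; first by lia.
  by rewrite span /e3 vec3Z vec3D; congr vec3; ring.
exists k => //; exists (vec3 i%:~R j%:~R 0).
  exists (\row_m nth 0 [:: ((i + j) %/ 2)%Z; ((i - j) %/ 2)%Z] m) => //.
  by rewrite span !mxE /=; congr (vec3 _%:~R _%:~R _); lia.
by rewrite /e3 vec3Z vec3D; congr vec3; ring.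
Qed.

(** The multipliers m and n absorb a common factor of the first two, respectively
the third, coordinates of all vectors of M. *)
Lemma int_points_rescale {R : realType} (a b : R) (m n : nat)
    (M M' : int -> int -> int -> Prop) :
  0 < a -> 0 < b -> (0 < m)%N -> (0 < n)%N ->
  (forall i j k, M i j k <-> exists i' j' k',
     [/\ i = i' * m%:Z, j = j' * m%:Z, k = k' * n%:Z & M' i' j' k']) ->
  set_mul (int_points a b M) (invmx (diag_aab (m%:R * a) (n%:R * b))) =
  int_points 1 1 M'.
Proof.
move=> a0 b0 m0 n0 MM'.
have ma0 : 0 < m%:R * a by rewrite mulr_gt0 ?ltr0n.
have nb0 : 0 < n%:R * b by rewrite mulr_gt0 ?ltr0n.
apply: set_mul_invmx => [|v]; first exact: diag_aab_unit.
rewrite (vec3_coord v) mul_diag_aab; split.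
  move=> [_ [_ [_ [/MM'[i [j [k [-> -> -> M'ijk]]]] /vec3_inj[]]]]].
  rewrite !rmorphM /= -!mulrA => /mulIf vi /mulIf vj /mulIf vk.
  exists i, j, k; split=> //.
  by rewrite vi ?vj ?vk ?gt_eqF ?mulr1.
move=> [i [j [k [M'ijk /vec3_inj[-> -> ->]]]]].
exists (i * m), (j * m), (k * n); split; first by apply/MM'; exists i, j, k.
by rewrite !rmorphM /= !mulr1 -!mulrA.
Qed.

(** * Lattices with the symmetry group *)

(** The scales a and b are half the generators of L on the x-axis and on the
z-axis.  Adding or subtracting symmetric images of a vector of L leaves twice one
coordinate on the corresponding axis, so every coordinate is an integral multiple
of half a generator, while on the axes themselves the multiple is even. *)
Lemma D4tilde_lattice_half_coordinates {R : realType} (L : set 'rV[R]_3) :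
  is_lattice 3 L -> preserved_by (D4tilde R) L ->
  exists a b M, [/\ 0 < a, 0 < b, L = int_points a b M &
    [/\ forall i j k i' j' k', M i j k -> M i' j' k' ->
          M (i - i') (j - j') (k - k'),
        forall i j k, M i j k -> M j i k,
        forall i, M i 0 0 <-> (2 %| i)%Z &
        forall k, M 0 0 k <-> (2 %| k)%Z]].
Proof.
move=> latL presL.
have LB u v : L u -> L v -> L (u - v) by apply: latticeB latL _ _.
have Lgen n v : [set e1 R; e1 R - e2 R] n -> L v -> L (v *m reflection n).
  move=> hn Lv; rewrite -(presL (reflection n)); first by exists v.
  by apply: sub_gen_smallest; case: hn => ->; [left|right].
have Leq u v : L u -> u = v -> L v by move=> Lu <-.
have Lsx x y z : L (vec3 x y z) -> L (vec3 (- x) y z).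
  move/(Lgen (e1 R) _ (or_introl erefl))/Leq; apply.
  by rewrite mul_reflection !dot_vec3 vec3Z vec3B; congr vec3; field.
have Lsw x y z : L (vec3 x y z) -> L (vec3 y x z).
  move/(Lgen (e1 R - e2 R) _ (or_intror erefl))/Leq; apply.
  by rewrite mul_reflection vec3B !dot_vec3 vec3Z vec3B; congr vec3; field.
have Lxaxis x y z : L (vec3 x y z) -> L ((2 * x) *: e1 R).
  move=> Lv; apply: (Leq _ _ (LB _ _ Lv (Lsx _ _ _ Lv))).
  by rewrite /e1 vec3Z vec3B; congr vec3; ring.
have Lzaxis x y z : L (vec3 x y z) -> L ((2 * z) *: e3 R).
  move=> Lv; have Lhalfturn := Lsx _ _ _ (Lsw _ _ _ (Lsx _ _ _ (Lsw _ _ _ Lv))).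
  apply: (Leq _ _ (LB _ _ Lv (LB _ _ (LB _ _ Lv Lv) Lhalfturn))).
  by rewrite /e3 vec3Z !vec3B; congr vec3; ring.
have e1_neq0 : e1 R != 0.
  by apply/eqP=> /rowP/(_ 0); rewrite !mxE; apply/eqP/oner_neq0.
have e3_neq0 : e3 R != 0.
  by apply/eqP=> /rowP/(_ 2%:R); rewrite !mxE; apply/eqP/oner_neq0.
have [u Lu u0] := lattice_coord_neq0 L 0 latL.
have [w Lw w0] := lattice_coord_neq0 L 2%:R latL.
rewrite (vec3_coord u) in Lu; rewrite (vec3_coord w) in Lw.
move: Lu Lw => /Lxaxis Lu /Lzaxis Lw.
have two_neq0 (t : R) : t != 0 -> 2 * t != 0.
  by move=> t0; rewrite mulf_neq0 ?pnatr_eq0.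
have [a a0 La] := lattice_line_cyclic L _ _ latL Lu (two_neq0 _ u0) e1_neq0.
have [b b0 Lb] := lattice_line_cyclic L _ _ latL Lw (two_neq0 _ w0) e3_neq0.
have half (t g : R) (i : int) : 2 * t = i%:~R * g -> t = i%:~R * (g / 2).
  by move=> h; rewrite mulrA -h; field.
have even (g : R) (i : int) : 0 < g ->
    (exists k : int, i%:~R * (g / 2) = k%:~R * g) <-> (2 %| i)%Z.
  move=> g0; split=> [[k hk]|/dvdzP[k ->]]; last first.
    by exists k; rewrite rmorphM /=; field.
  apply/dvdzP; exists k; apply: (@intr_inj R); rewrite rmorphM /=.
  have gN0 : g != 0 by rewrite gt_eqF.
  by apply: (mulIf gN0); rewrite mulrAC -hk; field.
exists (a / 2), (b / 2).
exists (fun i j k => L (vec3 (i%:~R * (a / 2)) (j%:~R * (a / 2)) (k%:~R * (b / 2)))).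
split; rewrite ?divr_gt0 //; last split.
- apply/seteqP; split=> [v|_ [i [j [k [? ->]]]] //].
  rewrite (vec3_coord v) => Lv.
  have /La[i /half vi] := Lxaxis _ _ _ Lv.
  have /La[j /half vj] := Lxaxis _ _ _ (Lsw _ _ _ Lv).
  have /Lb[k /half vk] := Lzaxis _ _ _ Lv.
  by exists i, j, k; rewrite -vi -vj -vk.
- move=> i j k i' j' k' h h'; have := LB _ _ h h'.
  by rewrite vec3B !rmorphB /= !mulrBl.
- by move=> i j k; apply: Lsw.
- move=> i; rewrite -(even a i a0) -La /e1 vec3Z.
  by rewrite mulr1 !mulr0 !mul0r.
- move=> k; rewrite -(even b k b0) -Lb /e3 vec3Z.
  by rewrite mulr1 !mulr0 !mul0r.
Qed.

Theorem lemma4p4 (R : realType) (L : set 'rV[R]_3)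
    (hL : is_lattice 3 L) (hG : preserved_by (D4tilde R) L) :
  exists a b : R, [/\ 0 < a, 0 < b &
    [set Lambda100 R; Lambda111 R; Lambda110 R;
         lattice_oplus (Lambda11 R) (e3 R)]
      (set_mul L (invmx (diag_aab a b)))].
Proof.
have [a [b [M [a0 b0 -> [MB Msw Mx Mz]]]]] :=
  D4tilde_lattice_half_coordinates L hL hG.
rewrite Lambda100E Lambda111E Lambda110E Lambda11_oplus_e3E.
set targets := [set _; _; _; _].
have conclude m n M' : (0 < m)%N -> (0 < n)%N -> targets (int_points 1 1 M') ->
    (forall i j k, M i j k <-> exists i' j' k',
      [/\ i = i' * m%:Z, j = j' * m%:Z, k = k' * n%:Z & M' i' j' k']) ->
    exists a' b', [/\ 0 < a', 0 < b' &
      targets (set_mul (int_points a b M) (invmx (diag_aab a' b')))].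
  move=> m0 n0 tM' MM'; exists (m%:R * a), (n%:R * b).
  rewrite !mulr_gt0 ?ltr0n //; split=> //.
  by rewrite (int_points_rescale a b m n M M').
have [HM|HM|HM|HM] := swap_invariant_classification M MB Msw Mx Mz.
- apply: (conclude 2 2) => // [|i j k]; first by left; left; left.
  rewrite HM; split=> [/and3P[/dvdzP[x ->] /dvdzP[y ->] /dvdzP[z ->]]|].
    by exists x, y, z.
  by move=> [x [y [z [-> -> -> _]]]]; rewrite !dvdz_mull.
- apply: (conclude 1 1) => // [|i j k]; first by left; left; right.
  rewrite HM; split=> [h|[x [y [z []]]]]; last by rewrite !mulr1 => -> -> ->.
  by exists i, j, k; rewrite !mulr1.
- apply: (conclude 1 1) => // [|i j k]; first by left; right.
  rewrite HM; split=> [h|[x [y [z []]]]]; last by rewrite !mulr1 => -> -> ->.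
  by exists i, j, k; rewrite !mulr1.
- apply: (conclude 1 2) => // [|i j k]; first by right.
  rewrite HM; split=> [/andP[ij /dvdzP[z ->]]|[x [y [z [-> -> -> xy]]]]].
    by exists i, j, z; rewrite !mulr1.
  by rewrite !mulr1 xy dvdz_mull.
Qed.
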